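(* Let $0<l_2\le l_1$ be real numbers and put $\angle A_{\max}=\pi-2\arctan(l_2/l_1)$. If $0<\theta<\angle A_{\max}$, then there exists a unique triangle $ABC$ with $l_a=l_2$, $l_b=l_1$ and $\angle A=\theta$. If $\theta$ does not lie in this interval, no such triangle exists.
   Context: For a non-degenerate triangle $ABC$ in the Euclidean plane, $\angle A,\angle B,\angle C$ are its interior angles; $l_a$ and $l_b$ denote the lengths of the internal angle bisectors drawn from $A$ and $B$ respectively, measured from the vertex to the opposite side. Uniqueness of triangles is understood up to congruence respecting the vertex labels. *)

(* Defs.v *)
(* Written over Stdlib's classical real numbers. *)
From Stdlib Require Import Reals.
Open Scope R_scope.

Definition point : Type := (R * R)%type.

Definition edist (P Q : point) : R := dist_euc (fst P) (snd P) (fst Q) (snd Q).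

Definition dot (O P Q : point) : R :=
  (fst P - fst O) * (fst Q - fst O) + (snd P - snd O) * (snd Q - snd O).

Definition collinear (A B C : point) : Prop :=
  (fst B - fst A) * (snd C - snd A) - (snd B - snd A) * (fst C - fst A) = 0.

Definition triangle (A B C : point) : Prop := ~ collinear A B C.

(* The unoriented angle P O Q, in [0, PI]; it is only meaningful when P and Q
   both differ from O, which holds wherever it is used below. *)
Definition angle (P O Q : point) : R :=
  acos (dot O P Q / (edist O P * edist O Q)).

Definition on_segment (P Q D : point) : Prop :=
  exists t : R, 0 <= t <= 1 /\
    D = ((1 - t) * fst P + t * fst Q, (1 - t) * snd P + t * snd Q).

(* The internal bisector from A, drawn to the opposite side BC, ends at D.  As
   D lies between B and C, the equality of the unoriented angles excludes the
   external bisector. *)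
Definition bisector_foot (A B C D : point) : Prop :=
  on_segment B C D /\ angle B A D = angle D A C.

(* For a non-degenerate triangle the foot exists and is unique, so this is the
   graph of the function giving the length of the bisector from A. *)
Definition bisector_length (A B C : point) (l : R) : Prop :=
  exists D : point, bisector_foot A B C D /\ edist A D = l.

Definition isometry (f : point -> point) : Prop :=
  forall P Q : point, edist (f P) (f Q) = edist P Q.

(* Orientation-reversing isometries are allowed. *)
Definition congruent (A B C A' B' C' : point) : Prop :=
  exists f : point -> point, isometry f /\ f A = A' /\ f B = B' /\ f C = C'.

Definition triangle_with (la lb theta : R) (A B C : point) : Prop :=
  triangle A B C /\
  bisector_length A B C la /\
  bisector_length B C A lb /\
  angle B A C = theta.

Definition angleA_max (l1 l2 : R) : R := PI - 2 * atan (l2 / l1).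

(* Main.v *)
From Stdlib Require Import Reals Lra Psatz.
From Coquelicot Require Import Coquelicot.
Require Import Defs.
Open Scope R_scope.

(** Write k = cos A and let s = AE / AB, where E is the foot of the bisector
    from B.  Up to congruence a triangle is given by c = AB, k and s, with s in
    (0, 1), and all side lengths are c times rational functions of k and s:
    l_b^2 = c^2 Q with Q = 1 + s^2 - 2 s k, and AC = 2 c N / (1 - s^2) with
    N = s (1 - k s).  Hence (l_a / l_b)^2 = 8 (1 + k) N^2 / (D^2 Q), where
    D = 1 + 2 s - (1 + 2 k) s^2.  For fixed k this increases strictly from 0 at
    s = 0 to (1 + k) / (1 - k) = cot^2 (A / 2) at s = 1, so it takes the value
    (l_2 / l_1)^2 exactly when A < pi - 2 arctan (l_2 / l_1), and only once. *)

(** * The squared ratio of the bisectors as an increasing function of s *)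

Section Ratio.

Variable k : R.
Hypothesis hk : -1 < k < 1.

Definition ratio_num (s : R) := s * (1 - k * s).
Definition ratio_den (s : R) := 1 + 2 * s - (1 + 2 * k) * s ^ 2.
(** Law of cosines in triangle ABE, scaled so that AB = 1 and AE = s. *)
Definition quad (s : R) := 1 + s ^ 2 - 2 * s * k.

Lemma one_sub_mul_pos (s : R) : 0 <= s <= 1 -> 0 < 1 - k * s.
Proof. intros hs; nra. Qed.

Lemma ratio_den_pos (s : R) : 0 <= s <= 1 -> 0 < ratio_den s.
Proof.
  intros hs; pose proof (one_sub_mul_pos s hs).
  replace (ratio_den s) with ((1 - s) * (1 + s) + 2 * s * (1 - k * s)) by (unfold ratio_den; ring).
  destruct (Rle_lt_or_eq_dec s 1 (proj2 hs)) as [h | ->]; nra.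
Qed.

Lemma quad_pos (s : R) : 0 < quad s.
Proof.
  replace (quad s) with ((s - k) ^ 2 + (1 - k) * (1 + k)) by (unfold quad; ring).
  pose proof (pow2_ge_0 (s - k)).
  assert (0 < (1 - k) * (1 + k)) by (apply Rmult_lt_0_compat; lra). lra.
Qed.

(* As Q = (1 - k s) + s (s - k), AM-GM gives Q^2 >= 4 s (1 - k s) (s - k),
   while D < (1 + s)^2 < 4. *)
Lemma quad_sqr_gt (s : R) : 0 < s < 1 -> ratio_num s * ratio_den s * (s - k) < quad s ^ 2.
Proof.
  intros hs.
  assert (hm : 0 < 1 - k * s) by (apply one_sub_mul_pos; lra).
  assert (hD : 0 < ratio_den s) by (apply ratio_den_pos; lra).
  pose proof (quad_pos s) as hQ.
  assert (hN : 0 < ratio_num s) by (unfold ratio_num; nra).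
  destruct (Rle_lt_dec s k) as [h | h].
  - assert (0 <= ratio_num s * ratio_den s * (k - s)) by (apply Rmult_le_pos; nra). nra.
  - assert (hD4 : ratio_den s < 4).
    { unfold ratio_den. assert (0 < (1 + k) * s ^ 2) by (apply Rmult_lt_0_compat; nra). nra. }
    assert (hP : 0 < ratio_num s * (s - k)) by (apply Rmult_lt_0_compat; lra).
    assert (hA : 4 * (ratio_num s * (s - k)) <= quad s ^ 2).
    { assert (E : quad s ^ 2 - 4 * (ratio_num s * (s - k)) = ((1 - k * s) - s * (s - k)) ^ 2)
        by (unfold quad, ratio_num; ring).
      pose proof (pow2_ge_0 ((1 - k * s) - s * (s - k))). lra. }
    nra.
Qed.

Definition ratio (s : R) := 8 * (1 + k) * ratio_num s ^ 2 / (ratio_den s ^ 2 * quad s).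

(** With N, D, Q as above, N' D - N D' = Q, so the numerator of the derivative collapses to this
    product; its sign is that of the difference treated in [quad_sqr_gt]. *)
Definition ratio_deriv (s : R) :=
  16 * (1 + k) * ratio_num s * (quad s ^ 2 - ratio_num s * ratio_den s * (s - k)) /
    (ratio_den s ^ 3 * quad s ^ 2).

Lemma is_derive_ratio (s : R) : 0 <= s <= 1 -> is_derive ratio s (ratio_deriv s).
Proof.
  intros hs.
  pose proof (ratio_den_pos s hs) as hD. pose proof (quad_pos s) as hQ.
  unfold ratio, ratio_deriv, ratio_num, ratio_den, quad in *. auto_derive.
  - apply Rgt_not_eq.
    replace (_ * _ * _)
      with ((1 + 2 * s - (1 + 2 * k) * s ^ 2) ^ 2 * (1 + s ^ 2 - 2 * s * k)) by ring.
    apply Rmult_lt_0_compat; [apply pow_lt |]; assumption.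
  - field. split; apply Rgt_not_eq; nra.
Qed.

Lemma ratio_increasing (s t : R) : 0 <= s -> s < t -> t <= 1 -> ratio s < ratio t.
Proof.
  intros hs hst ht.
  (* The intermediate point is interior to [0, 1], which matters because the derivative vanishes at
     0. *)
  destruct (MVT_cor2 ratio ratio_deriv s t hst) as [x [E hx]].
  { intros x hx. apply is_derive_Reals, is_derive_ratio. lra. }
  assert (0 < 1 - k * x) by (apply one_sub_mul_pos; lra).
  assert (0 < ratio_den x) by (apply ratio_den_pos; lra).
  pose proof (quad_pos x).
  assert (h := quad_sqr_gt x ltac:(lra)).
  assert (0 < ratio_num x) by (unfold ratio_num; nra).
  assert (0 < ratio_deriv x).
  { apply Rdiv_lt_0_compat; [repeat apply Rmult_lt_0_compat; lra |].
    apply Rmult_lt_0_compat; apply pow_lt; assumption. }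
  nra.
Qed.

End Ratio.

(** * The range of the ratio *)

Lemma ratio_1 (k : R) : k < 1 -> ratio k 1 = (1 + k) / (1 - k).
Proof.
  intros hk; unfold ratio, ratio_num, ratio_den, quad; field.
  repeat split; lra.
Qed.

Lemma ratio_surjective (k y : R) : -1 < k < 1 -> 0 < y < (1 + k) / (1 - k) ->
  exists s, 0 < s < 1 /\ ratio k s = y.
Proof.
  intros hk hy.
  (* Clearing denominators gives a polynomial, continuous on all of R as [IVT] asks, whereas
     [ratio_den] is known to be nonzero only on [0, 1]. *)
  set (h := fun s => 8 * (1 + k) * ratio_num k s ^ 2 - y * (ratio_den k s ^ 2 * quad k s)).
  assert (hc : continuity h).
  { unfold h, ratio_num, ratio_den, quad. reg. }
  assert (h0 : h 0 = - y) by (unfold h, ratio_num, ratio_den, quad; ring).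
  assert (h1 : 0 < h 1).
  { replace (h 1) with (8 * (1 - k) ^ 3 * ((1 + k) / (1 - k) - y))
      by (unfold h, ratio_num, ratio_den, quad; field; lra).
    repeat apply Rmult_lt_0_compat; lra. }
  destruct (IVT h 0 1 hc) as [s [hs E]]; try lra.
  exists s. split.
  - assert (s <> 0) by (intros ->; lra). assert (s <> 1) by (intros ->; lra). lra.
  - pose proof (ratio_den_pos k hk s hs). pose proof (quad_pos k hk s).
    unfold h in E. unfold ratio. apply Rmult_eq_reg_r with (ratio_den k s ^ 2 * quad k s).
    + field_simplify; [lra |]. split; lra.
    + apply Rgt_not_eq, Rmult_lt_0_compat; [apply pow_lt |]; assumption.
Qed.

(** * The threshold angle in terms of cosines *)

Lemma cos_bound_lt (x : R) : 0 < x < PI -> -1 < cos x < 1.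
Proof.
  intros hx. rewrite <- cos_PI at 1. rewrite <- cos_0.
  split; apply cos_decreasing_1; lra.
Qed.

(** With r = l2 / l1, the double-angle formula gives cos ([angleA_max]) = (r^2 - 1) / (r^2 + 1),
    which the increasing map x -> (1 + x) / (1 - x) sends to r^2; the cosine itself is
    decreasing. *)
Lemma lt_angleA_max (l1 l2 theta : R) : 0 < l2 -> 0 < l1 -> 0 < theta < PI ->
  (theta < angleA_max l1 l2 <-> (l2 / l1) ^ 2 < (1 + cos theta) / (1 - cos theta)).
Proof.
  intros h2 h1 ht; unfold angleA_max; set (r := l2 / l1).
  assert (hr : 0 < r) by (apply Rdiv_lt_0_compat; assumption).
  assert (hk := cos_bound_lt theta ht).
  assert (ha : 0 < atan r < PI / 2).
  { split; [rewrite <- atan_0; apply atan_increasing; assumption |].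
    apply atan_bound. }
  assert (hcos : cos (PI - 2 * atan r) * (1 + r ^ 2) = r ^ 2 - 1).
  { rewrite Rtrigo_facts.cos_pi_minus, cos_2a_cos, cos_atan.
    assert (hq : sqrt (1 + r²) * sqrt (1 + r²) = 1 + r ^ 2)
      by (rewrite sqrt_sqrt; unfold Rsqr; nra).
    assert (0 < sqrt (1 + r²)) by (apply sqrt_lt_R0; unfold Rsqr; nra).
    rewrite <- hq. field_simplify; [| lra]. nra. }
  assert (E : (1 + cos theta) / (1 - cos theta) - r ^ 2 =
              (cos theta - cos (PI - 2 * atan r)) * ((1 + r ^ 2) / (1 - cos theta))).
  { replace (cos (PI - 2 * atan r)) with ((r ^ 2 - 1) / (1 + r ^ 2))
      by (rewrite <- hcos; field; nra).
    field. split; nra. }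
  assert (hp : 0 < (1 + r ^ 2) / (1 - cos theta)) by (apply Rdiv_lt_0_compat; nra).
  split; intros h.
  - assert (cos (PI - 2 * atan r) < cos theta) by (apply cos_decreasing_1; lra). nra.
  - apply cos_decreasing_0; try lra. nra.
Qed.

(** * Distances, dot products and angles in coordinates *)

Lemma edist_ge0 (P Q : point) : 0 <= edist P Q.
Proof. apply sqrt_pos. Qed.

Lemma edist_sqr (P Q : point) :
  edist P Q ^ 2 = (fst P - fst Q) ^ 2 + (snd P - snd Q) ^ 2.
Proof.
  unfold edist, dist_euc. rewrite pow2_sqrt by (apply Rplus_le_le_0_compat; apply Rle_0_sqr).
  unfold Rsqr; ring. Qed.

Lemma edist_sym (P Q : point) : edist P Q = edist Q P.
Proof. apply distance_symm. Qed.

Lemma sqr_inj (x y : R) : 0 <= x -> 0 <= y -> x ^ 2 = y ^ 2 -> x = y.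
Proof. intros hx hy h. apply Rsqr_inj; unfold Rsqr; lra. Qed.

(** Twice the signed area of OPQ; [triangle A B C] unfolds to [cross A B C <> 0]. *)
Definition cross (O P Q : point) : R :=
  (fst P - fst O) * (snd Q - snd O) - (snd P - snd O) * (fst Q - fst O).

(** Lagrange's identity. It yields Cauchy-Schwarz, strictly for triangles, and determines [cross] up
    to sign. *)
Lemma dot_cross_sqr (O P Q : point) :
  dot O P Q ^ 2 + cross O P Q ^ 2 = (edist O P * edist O Q) ^ 2.
Proof. rewrite Rpow_mult_distr, !edist_sqr; unfold dot, cross; ring. Qed.

Lemma law_of_cosines (A B C : point) :
  edist B C ^ 2 = edist A B ^ 2 + edist A C ^ 2 - 2 * dot A B C.
Proof. rewrite !edist_sqr; unfold dot; ring. Qed.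

(** Expresses the bisector from B through data at the vertex A. *)
Lemma dot_swap (A B C : point) : dot B C A = edist A B ^ 2 - dot A B C.
Proof. rewrite edist_sqr; unfold dot; ring. Qed.

Lemma triangle_rot (A B C : point) : triangle A B C -> triangle B C A.
Proof. unfold triangle, collinear; intros h h'; apply h; nra. Qed.

Lemma dot_bound (O P Q : point) :
  - (edist O P * edist O Q) <= dot O P Q <= edist O P * edist O Q.
Proof.
  pose proof (dot_cross_sqr O P Q).
  assert (0 <= edist O P * edist O Q) by (apply Rmult_le_pos; apply edist_ge0).
  pose proof (pow2_ge_0 (cross O P Q)). split; nra.
Qed.

Lemma dot_cos_angle (O P Q : point) :
  dot O P Q = edist O P * edist O Q * cos (angle P O Q).
Proof.
  pose proof (dot_bound O P Q) as h. unfold angle.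
  set (m := edist O P * edist O Q) in *.
  (* If a leg has length 0, the quotient inside [angle] is meaningless, but Cauchy-Schwarz forces
     the dot product to be 0 as well. *)
  destruct (Req_dec m 0) as [E | E]; [rewrite E in h |- *; lra |].
  assert (0 < m) by lra.
  rewrite cos_acos; [field; assumption |].
  split; [apply Rle_div_r | apply Rle_div_l]; lra.
Qed.

Lemma triangle_side_pos (A B C : point) : triangle A B C -> 0 < edist A B.
Proof.
  intros h. destruct (edist_ge0 A B) as [h' | h']; [assumption | exfalso].
  pose proof (edist_sqr A B) as E. rewrite <- h' in E.
  pose proof (pow2_ge_0 (fst A - fst B)). pose proof (pow2_ge_0 (snd A - snd B)).
  assert (fst A - fst B = 0) by (apply Rsqr_0_uniq; unfold Rsqr; lra).
  assert (snd A - snd B = 0) by (apply Rsqr_0_uniq; unfold Rsqr; lra).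
  apply h. unfold collinear.
  replace (fst B) with (fst A) by lra. replace (snd B) with (snd A) by lra. ring.
Qed.

Lemma triangle_dot_bound (A B C : point) : triangle A B C ->
  - (edist A B * edist A C) < dot A B C < edist A B * edist A C.
Proof.
  intros h. pose proof (dot_cross_sqr A B C) as E.
  assert (hc : 0 < cross A B C ^ 2) by (apply pow2_gt_0; exact h).
  pose proof (dot_bound A B C) as [h1 h2].
  split.
  - destruct h1 as [h1 | h1]; [assumption | rewrite <- h1 in E; lra].
  - destruct h2 as [h2 | h2]; [assumption | rewrite h2 in E; lra].
Qed.

Lemma angle_eq (O P Q : point) (theta : R) : 0 < edist O P -> 0 < edist O Q ->
  0 <= theta <= PI -> dot O P Q = edist O P * edist O Q * cos theta ->
  angle P O Q = theta.
Proof.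
  intros hP hQ ht E. unfold angle. rewrite E.
  rewrite <- (acos_cos theta) at 2 by assumption.
  f_equal. field. lra.
Qed.

Lemma triangle_angle_bound (A B C : point) : triangle A B C -> 0 < angle B A C < PI.
Proof.
  intros h. pose proof (triangle_dot_bound A B C h) as hd.
  rewrite (dot_cos_angle A B C) in hd. unfold angle in *.
  pose proof (acos_bound (dot A B C / (edist A B * edist A C))) as [h1 h2].
  split.
  - destruct h1 as [h1 | h1]; [assumption | rewrite <- h1, cos_0 in hd; lra].
  - destruct h2 as [h2 | h2]; [assumption | rewrite h2, cos_PI in hd; lra].
Qed.

(** * The length of an angle bisector *)

(** This is l = 2 b c cos (A / 2) / (b + c) in polynomial form, with b c cos A written as a dot
    product; it eliminates the foot and the angles. *)
Lemma bisector_length_iff (A B C : point) (l : R) : triangle A B C ->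
  (bisector_length A B C l <->
   0 <= l /\
   l ^ 2 * (edist A B + edist A C) ^ 2 =
     2 * (edist A B * edist A C) * (edist A B * edist A C + dot A B C)).
Proof.
  intros h.
  assert (hc := triangle_side_pos A B C h).
  assert (hb : 0 < edist A C).
  { rewrite edist_sym. apply triangle_side_pos with B. now apply triangle_rot, triangle_rot. }
  assert (hp := triangle_dot_bound A B C h).
  assert (EB := edist_sqr A B). assert (EC := edist_sqr A C).
  set (c := edist A B) in *. set (b := edist A C) in *. set (p := dot A B C) in *.
  (* All quantities attached to a point of BC become polynomials in t, b, c and p, so coordinates
     can be forgotten. *)
  pose (pt := fun t => ((1 - t) * fst B + t * fst C, (1 - t) * snd B + t * snd C) : point).
  assert (E1 : forall t, dot A B (pt t) = (1 - t) * c ^ 2 + t * p).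
  { intros t. rewrite EB. unfold p, dot, pt; simpl. ring. }
  assert (E2 : forall t, dot A (pt t) C = (1 - t) * p + t * b ^ 2).
  { intros t. rewrite EC. unfold p, dot, pt; simpl. ring. }
  assert (E3 : forall t, edist A (pt t) ^ 2 =
    (1 - t) ^ 2 * c ^ 2 + 2 * t * (1 - t) * p + t ^ 2 * b ^ 2).
  { intros t. rewrite edist_sqr, EB, EC. unfold p, dot, pt; simpl. ring. }
  split.
  - intros [D [[[t [ht ->]] ha] <-]]. fold (pt t) in *.
    split; [apply edist_ge0 |].
    pose proof (dot_cos_angle A B (pt t)) as D1. pose proof (dot_cos_angle A (pt t) C) as D2.
    rewrite ha, E1 in D1. rewrite E2 in D2. fold c in D1. fold b in D2.
    (* Eliminating the common cosine from [D1] and [D2] gives this product. Since p < b c strictly,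
       BD : DC = c : b, the angle bisector theorem. *)
    assert (F : (b * c - p) * ((1 - t) * c - t * b) = 0) by nra.
    assert (G : (1 - t) * c - t * b = 0).
    { apply Rmult_integral in F as [F | F]; [nra | assumption]. }
    assert (T : t = c / (c + b))
      by (apply Rmult_eq_reg_r with (c + b); [field_simplify; lra | lra]).
    rewrite E3, T. field. lra.
  - intros [hl E]. exists (pt (c / (c + b))).
    assert (L : edist A (pt (c / (c + b))) = l).
    { apply sqr_inj; [apply edist_ge0 | assumption |].
      rewrite E3. apply Rmult_eq_reg_r with ((c + b) ^ 2); [| apply pow_nonzero; lra].
      rewrite E. field. lra. }
    (* Needed to cancel AD in the two [acos] quotients below. *)
    assert (hl' : l <> 0).
    { intros ->. assert (0 < 2 * (c * b) * (c * b + p))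
        by (repeat apply Rmult_lt_0_compat; lra).
      lra. }
    split; [split |].
    + exists (c / (c + b)). split; [| reflexivity].
      split; [apply Rlt_le, Rdiv_lt_0_compat; lra | apply Rle_div_l; lra].
    + unfold angle. rewrite E1, E2, L. fold c b. f_equal. field. lra.
    + exact L.
Qed.

(** * Congruence by two sides and the included dot product *)

Lemma congruent_of_sides (A B C A' B' C' : point) : triangle A B C ->
  edist A B = edist A' B' -> edist A C = edist A' C' -> dot A B C = dot A' B' C' ->
  congruent A B C A' B' C'.
Proof.
  intros h HB HC HD.
  assert (hc := triangle_side_pos A B C h).
  (* The two cross products have equal squares; e = -1 is the case of opposite orientations. *)
  assert (X : exists e, e ^ 2 = 1 /\ cross A' B' C' = e * cross A B C).
  { pose proof (dot_cross_sqr A B C) as E. pose proof (dot_cross_sqr A' B' C') as E'.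
    rewrite <- HB, <- HC, <- HD in E'.
    assert (F : (cross A' B' C' - cross A B C) * (cross A' B' C' + cross A B C) = 0) by nra.
    apply Rmult_integral in F as [F | F]; [exists 1 | exists (-1)]; lra. }
  destruct X as [e [he HX]].
  set (c := edist A B) in *.
  assert (N1 : c ^ 2 = (fst B - fst A) ^ 2 + (snd B - snd A) ^ 2)
    by (unfold c; rewrite edist_sqr; ring).
  assert (N2 : c ^ 2 = (fst B' - fst A') ^ 2 + (snd B' - snd A') ^ 2)
    by (rewrite HB, edist_sqr; ring).
  assert (hc2 : c ^ 2 <> 0) by (apply pow_nonzero; lra).
  (* The coordinates of P in the orthogonal frame formed by AB and its quarter turn are
     [dot A B P / c ^ 2] and [cross A B P / c ^ 2]. They are reused in the frame of A'B', whose
     second axis is flipped when e = -1. *)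
  exists (fun P =>
    (fst A' + (dot A B P * (fst B' - fst A') - e * cross A B P * (snd B' - snd A')) / c ^ 2,
     snd A' + (dot A B P * (snd B' - snd A') + e * cross A B P * (fst B' - fst A')) / c ^ 2)).
  repeat split.
  - intros P Q. apply sqr_inj; try apply edist_ge0. rewrite !edist_sqr. simpl.
    transitivity (((dot A B P - dot A B Q) ^ 2 + e ^ 2 * (cross A B P - cross A B Q) ^ 2)
      * ((fst B' - fst A') ^ 2 + (snd B' - snd A') ^ 2) / (c ^ 2) ^ 2); [field; lra |].
    rewrite <- N2, he. apply Rmult_eq_reg_r with (c ^ 2); [| assumption].
    transitivity ((dot A B P - dot A B Q) ^ 2 + (cross A B P - cross A B Q) ^ 2); [field; lra |].
    rewrite N1. unfold dot, cross. ring.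
  - replace (dot A B A) with 0 by (unfold dot; ring).
    replace (cross A B A) with 0 by (unfold cross; ring).
    destruct A' as [x y]; simpl. f_equal; field; lra.
  - replace (dot A B B) with (c ^ 2) by (rewrite N1; unfold dot; ring).
    replace (cross A B B) with 0 by (unfold cross; ring).
    destruct B' as [x y]; simpl. f_equal; field; lra.
  - rewrite <- HX, HD. destruct C' as [x y].
    f_equal; apply Rmult_eq_reg_r with (c ^ 2); try assumption;
      field_simplify; try lra; rewrite ?N2; unfold dot, cross; simpl; ring.
Qed.

(** * Passing between triangles and the parameter s *)

(* The foot E of the bisector from B has AE = b c / (a + c), so s = b / (a + c). *)
Lemma side_relations (la lb theta : R) (A B C : point) : 0 < la -> 0 < lb ->
  triangle_with la lb theta A B C ->
  0 < theta < PI /\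
  exists s, 0 < s < 1 /\ ratio (cos theta) s = la ^ 2 / lb ^ 2 /\
    edist A B ^ 2 * quad (cos theta) s = lb ^ 2 /\
    edist A C = edist A B * (2 * ratio_num (cos theta) s / (1 - s ^ 2)).
Proof.
  intros hla hlb [h [ha [hb ht]]].
  assert (h' := triangle_rot _ _ _ h).
  assert (hc := triangle_side_pos _ _ _ h).
  assert (hsa := triangle_side_pos _ _ _ h').
  assert (hsb := triangle_side_pos _ _ _ (triangle_rot _ _ _ h')).
  assert (htheta := triangle_angle_bound _ _ _ h). rewrite ht in htheta.
  split; [exact htheta |].
  apply bisector_length_iff in ha as [_ ha]; [| assumption].
  apply bisector_length_iff in hb as [_ hb]; [| assumption].
  assert (hq := triangle_dot_bound _ _ _ h').
  assert (hp := triangle_dot_bound _ _ _ h).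
  assert (hcos := law_of_cosines A B C).
  rewrite dot_swap in hb, hq.
  rewrite (edist_sym C A) in hsb.
  rewrite (edist_sym B A) in hb, hq.
  assert (hd := dot_cos_angle A B C). rewrite ht in hd. rewrite hd in *. clear hd.
  set (c := edist A B) in *. set (b := edist A C) in *. set (a := edist B C) in *.
  assert (hk := cos_bound_lt theta ltac:(assumption)).
  set (k := cos theta) in *.
  assert (hbac : b < a + c) by nra.
  (* Replacing k by the sides turns every remaining relation into a rational identity in a, b, c. *)
  assert (hk' : k = (b ^ 2 + c ^ 2 - a ^ 2) / (2 * b * c)) by (rewrite hcos; field; lra).
  assert (hs : 0 < b / (a + c) < 1).
  { split; [apply Rdiv_lt_0_compat; lra | apply Rlt_div_l; lra]. }
  assert (hD : 0 < ratio_den k (b / (a + c))) by (apply ratio_den_pos; lra).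
  assert (hQ : 0 < quad k (b / (a + c))) by (apply quad_pos; assumption).
  assert (hlb2 : c ^ 2 * quad k (b / (a + c)) = lb ^ 2).
  { apply Rmult_eq_reg_r with ((a + c) ^ 2); [| apply pow_nonzero; lra].
    rewrite hb, hk'. unfold quad. field. lra. }
  assert (hac : (a + c) ^ 2 - b ^ 2 <> 0).
  { replace ((a + c) ^ 2 - b ^ 2) with ((a + c - b) * (a + c + b)) by ring.
    apply Rgt_not_eq, Rmult_lt_0_compat; lra. }
  assert (hb2 : b = c * (2 * ratio_num k (b / (a + c)) / (1 - (b / (a + c)) ^ 2))).
  { rewrite hk' at 1. unfold ratio_num. field. lra. }
  exists (b / (a + c)). repeat split; try assumption; try lra.
  assert (hla2 : la ^ 2 = 8 * (1 + k) * c ^ 2 * ratio_num k (b / (a + c)) ^ 2 /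
    ratio_den k (b / (a + c)) ^ 2).
  (* Together these give N / D = b / (2 (b + c)), which matches the bisector formula at A. *)
  { assert (E : ratio_den k (b / (a + c)) = (1 - (b / (a + c)) ^ 2) * (b + c) / c)
      by (rewrite hk' at 1; unfold ratio_den; field; lra).
    assert (E' : ratio_num k (b / (a + c)) = (1 - (b / (a + c)) ^ 2) * b / (2 * c))
      by (rewrite hk' at 1; unfold ratio_num; field; lra).
    rewrite E, E'. apply Rmult_eq_reg_r with ((c + b) ^ 2); [| apply pow_nonzero; lra].
    rewrite ha. field. lra. }
  rewrite hla2, <- hlb2. unfold ratio. field. lra.
Qed.

(** The shape is dictated by theta and s, and the scale c by l_b^2 = c^2 Q; the hypothesis on the
    ratio then makes l_a correct. *)
Lemma triangle_with_of_ratio (la lb theta s : R) : 0 < la -> 0 < lb -> 0 < theta < PI ->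
  0 < s < 1 -> ratio (cos theta) s = la ^ 2 / lb ^ 2 ->
  exists A B C : point, triangle_with la lb theta A B C.
Proof.
  intros hla hlb ht hs hr.
  assert (hk := cos_bound_lt theta ltac:(assumption)).
  assert (hsin : 0 < sin theta) by (apply sin_gt_0; lra).
  assert (hsc : sin theta ^ 2 = 1 - cos theta ^ 2)
    by (pose proof (sin2_cos2 theta); unfold Rsqr in *; lra).
  set (k := cos theta) in *.
  assert (hD := ratio_den_pos k hk s ltac:(lra)). assert (hQ := quad_pos k hk s).
  assert (hm := one_sub_mul_pos k hk s ltac:(lra)).
  assert (hs2 : 0 < 1 - s ^ 2) by nra.
  pose (c := lb / sqrt (quad k s)).
  assert (hc : 0 < c) by (apply Rdiv_lt_0_compat; [| apply sqrt_lt_R0]; assumption).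
  assert (hlb2 : lb ^ 2 = c ^ 2 * quad k s).
  { unfold c. rewrite <- (pow2_sqrt (quad k s)) at 2 by lra. field.
    apply Rgt_not_eq, sqrt_lt_R0; assumption. }
  assert (hla2 : la ^ 2 = 8 * (1 + k) * c ^ 2 * ratio_num k s ^ 2 / ratio_den k s ^ 2).
  { replace (la ^ 2) with (ratio k s * lb ^ 2) by (rewrite hr; field; lra).
    rewrite hlb2. unfold ratio. field. lra. }
  pose (b := c * (2 * ratio_num k s / (1 - s ^ 2))).
  (* Obtained by solving s = b / (a + c) for a. *)
  pose (a := c * (quad k s / (1 - s ^ 2))).
  assert (hb : 0 < b).
  { apply Rmult_lt_0_compat; [assumption |].
    apply Rdiv_lt_0_compat; [unfold ratio_num; nra | assumption]. }
  assert (ha : 0 < a).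
  { apply Rmult_lt_0_compat; [assumption | apply Rdiv_lt_0_compat; assumption]. }
  pose (A := (0, 0) : point). pose (B := (c, 0) : point).
  pose (C := (b * k, b * sin theta) : point).
  assert (EB : edist A B = c).
  { apply sqr_inj; [apply edist_ge0 | lra |]. rewrite edist_sqr; simpl; ring. }
  assert (EC : edist A C = b).
  { apply sqr_inj; [apply edist_ge0 | lra |]. rewrite edist_sqr; simpl.
    transitivity (b ^ 2 * (k ^ 2 + sin theta ^ 2)); [ring | rewrite hsc; ring]. }
  assert (ED : dot A B C = c * b * k) by (unfold dot; simpl; ring).
  assert (EA : edist B C = a).
  { apply sqr_inj; [apply edist_ge0 | lra |]. rewrite (law_of_cosines A), EB, EC, ED.
    unfold a, b, quad, ratio_num. field. lra. }
  assert (h : triangle A B C).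
  { unfold triangle, collinear; simpl. intros E.
    assert (0 < c * (b * sin theta))
      by (apply Rmult_lt_0_compat; [| apply Rmult_lt_0_compat]; assumption).
    lra. }
  exists A, B, C. split; [assumption |]. repeat split.
  - apply bisector_length_iff; [assumption |]. split; [lra |].
    rewrite EB, EC, ED, hla2.
    assert (E : ratio_den k s = (1 - s ^ 2) * (b + c) / c)
      by (unfold b, ratio_den, ratio_num; field; lra).
    assert (E' : ratio_num k s = (1 - s ^ 2) * b / (2 * c))
      by (unfold b; field; lra).
    rewrite E, E'. field. lra.
  - apply bisector_length_iff; [now apply triangle_rot |]. split; [lra |].
    rewrite (edist_sym B A), dot_swap, EA, EB, ED, hlb2.
    unfold a, b, quad, ratio_num. field. lra.
  - apply angle_eq; rewrite ?EB, ?EC; try assumption; lra.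
Qed.

(** * Existence, uniqueness and necessity of the angle bound *)

Theorem mainTheorem1 (l1 l2 theta : R) (hl2 : 0 < l2) (hl21 : l2 <= l1) :
  (0 < theta < angleA_max l1 l2 ->
     (exists A B C : point, triangle_with l2 l1 theta A B C) /\
     (forall A B C A' B' C' : point,
        triangle_with l2 l1 theta A B C ->
        triangle_with l2 l1 theta A' B' C' ->
        congruent A B C A' B' C')) /\
  (~ (0 < theta < angleA_max l1 l2) ->
     ~ exists A B C : point, triangle_with l2 l1 theta A B C).
Proof.
  assert (hl1 : 0 < l1) by lra.
  assert (hk := cos_bound_lt theta).
  assert (hr : l2 ^ 2 / l1 ^ 2 = (l2 / l1) ^ 2) by (field; lra).
  split.
  - intros ht. split.
    + assert (hmax : angleA_max l1 l2 < PI).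
      { unfold angleA_max. assert (0 < atan (l2 / l1)); [| lra].
        rewrite <- atan_0. apply atan_increasing, Rdiv_lt_0_compat; assumption. }
      assert (ht' : 0 < theta < PI) by lra.
      destruct (ratio_surjective (cos theta) (l2 ^ 2 / l1 ^ 2) (hk ht')) as [s [hs E]].
      { split; [apply Rdiv_lt_0_compat; apply pow_lt; assumption |].
        rewrite hr. apply lt_angleA_max; lra. }
      now apply triangle_with_of_ratio with s.
    + intros A B C A' B' C' h h'.
      destruct (side_relations _ _ _ _ _ _ hl2 hl1 h) as [ht' [s [hs [E [Ec Eb]]]]].
      destruct (side_relations _ _ _ _ _ _ hl2 hl1 h') as [_ [s' [hs' [E' [Ec' Eb']]]]].
      (* Both triangles give the same value of the strictly increasing ratio, so their shapes agree;
         l_b then fixes the scale. *)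
      assert (Es : s = s').
      { destruct (Rtotal_order s s') as [L | [L | L]]; [| assumption |];
          apply (ratio_increasing _ (hk ht')) in L; lra. }
      subst s'.
      assert (HB : edist A B = edist A' B').
      { apply sqr_inj; try apply edist_ge0.
        apply Rmult_eq_reg_r with (quad (cos theta) s); [lra |].
        apply Rgt_not_eq, quad_pos. exact (hk ht'). }
      assert (HC : edist A C = edist A' C') by now rewrite Eb, Eb', HB.
      apply congruent_of_sides; try assumption; [apply h |].
      destruct h as [_ [_ [_ h]]]. destruct h' as [_ [_ [_ h']]].
      now rewrite !dot_cos_angle, h, h', HB, HC.
  - intros hn [A [B [C h]]]. apply hn.
    destruct (side_relations _ _ _ _ _ _ hl2 hl1 h) as [ht [s [hs [E _]]]].
    split; [lra |]. apply lt_angleA_max; try assumption.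
    (* The bound is the value of the ratio at s = 1, and s < 1 makes the inequality strict. *)
    rewrite <- hr, <- E, <- ratio_1 by (apply hk; assumption).
    apply ratio_increasing; lra.
Qed.
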